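(* Let $\nu\ge 1$ be an integer and let $a_{n,2\nu}$ denote the heat invariants of the round unit sphere $S^{2\nu}$, i.e. the coefficients in $\sum_{k=0}^\infty\mu_k e^{-t\,k(k+2\nu-1)}\sim\sum_{n\ge0}a_{n,2\nu}t^{\,n-\nu}$ as $t\to0+$, where $\mu_0=1$ and $\mu_k=\frac{(2k+2\nu-1)(k+2\nu-2)!}{k!\,(2\nu-1)!}$ for $k\ge1$. Define constants $K_t^{\nu}$ by $$\prod_{\beta\in\{\frac12,\frac32,\dots,\nu-\frac32\}}(z^2-\beta^2)=\sum_{t=0}^{\nu-1}K_t^{\nu}z^{2\nu-2-2t}$$ (the empty product being $1$ when $\nu=1$). Then for every integer $n\ge0$, $$a_{n,2\nu}=\frac{1}{(2\nu-1)!}\Bigg(\sum_{t=0}^{\nu-1}\frac{(\nu-1-t)!}{(n-t)!}\Big(\nu-\tfrac12\Big)^{2n-2t}K_t^{\nu}+\sum_{t=0}^{\nu-1}K_t^{\nu}\sum_{p=\nu-t}^{n-t}(-1)^{p+\nu-t-1}\frac{(\nu-\frac12)^{2n-2t-2p}B_{2p}}{p\,(n-t-p)!\,(p-\nu+t)!}\Big(\frac{1}{2^{2p-1}}-1\Big)\Bigg),$$ where $B_{2p}$ are the Bernoulli numbers, $1/m!=0$ for negative integers $m$, and an inner sum with upper limit smaller than lower limit is zero.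
   Context: Bernoulli numbers are defined by $\frac{z}{e^z-1}=\sum_{m\ge0}B_m\frac{z^m}{m!}$. The eigenvalues $k(k+2\nu-1)$ with multiplicities $\mu_k$ are those of the nonnegative Laplace–Beltrami operator on the sphere of curvature $+1$. *)

(* Defs.v *)
From Stdlib Require Import Reals ZArith.
From Coquelicot Require Import Coquelicot.
Open Scope R_scope.

(* 1 / m! for an integer m, with the convention 1 / m! = 0 for m < 0. *)
Definition inv_fact (m : Z) : R :=
  if (m <? 0)%Z then 0 else / INR (fact (Z.to_nat m)).

Definition mult (nu k : nat) : R :=
  match k with
  | O => 1
  | S _ => (2 * INR k + 2 * INR nu - 1) * INR (fact (k + 2 * nu - 2))
           / (INR (fact k) * INR (fact (2 * nu - 1)))
  end.

Definition eigenvalue (nu k : nat) : R := INR k * (INR k + 2 * INR nu - 1).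

Definition heat_trace (nu : nat) (t : R) : R :=
  Series (fun k => mult nu k * exp (- t * eigenvalue nu k)).

(* Poincare asymptotic expansion as t -> 0+: for every N, the remainder after
   the term of index N is o(t^(N - nu)). *)
Definition heat_invariants (nu : nat) (a : nat -> R) : Prop :=
  forall N : nat,
    filterlim
      (fun t : R =>
         (heat_trace nu t
          - sum_n (fun n => a n * powerRZ t (Z.of_nat n - Z.of_nat nu)) N)
         / powerRZ t (Z.of_nat N - Z.of_nat nu))
      (at_right 0) (locally 0).

(* The generating function identity is required on a punctured real
   neighbourhood of 0, since the quotient is only defined for z <> 0; this
   determines B, including B 0 = 1. *)
Definition bernoulli_numbers (B : nat -> R) : Prop :=
  exists r : R, 0 < r /\
    forall z : R, 0 < Rabs z < r ->
      is_series (fun m => B m * (z ^ m / INR (fact m))) (z / (exp z - 1)).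

Fixpoint prod_lt (f : nat -> R) (n : nat) : R :=
  match n with
  | O => 1
  | S m => prod_lt f m * f m
  end.

(* The half-integers 1/2, 3/2, ..., nu - 3/2 are i + 1/2 for i < nu - 1. *)
Definition K_constants (nu : nat) (K : nat -> R) : Prop :=
  forall z : R,
    prod_lt (fun i => z ^ 2 - (INR i + 1 / 2) ^ 2) (nu - 1)
    = sum_n (fun t => K t * z ^ (2 * nu - 2 - 2 * t)) (nu - 1).

(* Main.v *)
Require Import Defs.
From Stdlib Require Import Reals ZArith Lra Lia.
From Coquelicot Require Import Coquelicot.
Open Scope R_scope.

(** Put c = nu - 1/2 and z = k + c. Then the eigenvalue is z^2 - c^2 and
    mu_k = 2 z P(z) / (2 nu - 1)! with P(z) = prod_beta (z^2 - beta^2). As P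
    vanishes at the half-integers below c, the heat trace is
    exp (c^2 t) / (2 nu - 1)! times the sum over s of
      K_s * 2 * sum_{j >= 0} (j + 1/2)^(2m+1) exp (- t (j + 1/2)^2),  m = nu - 1 - s.
    With h = sqrt t the inner sum is h^-(2m+1) times the sum of
    y^(2m+1) exp (-y^2) over the midpoints y = h (j + 1/2), whose full expansion
    in h is given by the midpoint Euler-Maclaurin formula: its coefficients
    B_k(1/2) / k! = (2^(1-k) - 1) B_k / k! are those inverting
    2 sinh (z/2) = exp (z/2) - exp (-z/2), and only the endpoint 0 contributes.
    Multiplying by exp (c^2 t) and comparing coefficients gives the formula. *)

(** * Taylor coefficients of (z/2) / sinh (z/2) *)

Lemma CV_radius_pos (a : nat -> R) (x l : R) :
  0 < x -> is_series (fun n => a n * x ^ n) l -> Rbar_lt 0 (CV_radius a).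
Proof.
  intros Hx Hs.
  destruct (Rbar_lt_le_dec 0 (CV_radius a)) as [H|H]; [exact H|].
  exfalso. apply (CV_disk_outside a x).
  - apply Rbar_le_lt_trans with 0; [exact H|].
    simpl. rewrite Rabs_pos_eq; lra.
  - apply ex_series_lim_0. now exists l.
Qed.

(* [mid_bern B k] is [B_k(1/2) / k!], the Taylor coefficient of
   (z/2) / sinh (z/2). *)
Definition mid_bern (B : nat -> R) (k : nat) : R :=
  (2 / 2 ^ k - 1) * B k / INR (fact k).

(** Taylor coefficients of 2 sinh (z/2), left as a difference of powers: the expansions at
    [y + h / 2] and [y - h / 2] combine in this form in [central_difference]. *)
Definition two_sinh_coef (k : nat) : R :=
  ((1 / 2) ^ k - (- (1 / 2)) ^ k) / INR (fact k).

Lemma two_sinh_is_pseries (z : R) :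
  is_series (fun n => two_sinh_coef n * z ^ n) (exp (z / 2) - exp (- (z / 2))).
Proof.
  assert (H : forall x, is_series (fun n => / INR (fact n) * x ^ n) (exp x)).
  { intro x. apply is_pseries_R, is_exp_Reals. }
  generalize (is_series_minus _ _ _ _ (H (z / 2)) (H (- (z / 2)))).
  apply is_series_ext. intro n. unfold plus, opp, two_sinh_coef; simpl.
  replace (z / 2) with (z * (1 / 2)) by field.
  replace (- (z * (1 / 2))) with (z * (- (1 / 2))) by ring.
  rewrite !Rpow_mult_distr. field. apply INR_fact_neq_0.
Qed.

(** With w = exp (z/2), z / (w - 1/w) = z / (w - 1) - z / (w^2 - 1), which is twice the Bernoulli
    series at z/2 minus the one at z. *)
Lemma mid_bern_is_pseries (B : nat -> R) :
  bernoulli_numbers B ->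
  exists r, 0 < r /\ forall z, 0 < Rabs z < r ->
    is_series (fun k => mid_bern B k * z ^ k)
      (z / (exp (z / 2) - exp (- (z / 2)))).
Proof.
  intros [r [Hr HB]]. exists r. split; [exact Hr|]. intros z Hz.
  assert (Hz2 : 0 < Rabs (z / 2) < r).
  { unfold Rdiv. rewrite Rabs_mult, (Rabs_pos_eq (/ 2)) by lra. lra. }
  assert (Hz0 : z <> 0).
  { intro E. subst z. rewrite Rabs_R0 in Hz. lra. }
  assert (He : exp (z / 2) <> 1).
  { intro E. rewrite <- exp_0 in E. apply exp_inv in E. lra. }
  assert (Hpos := exp_pos (z / 2)).
  generalize (is_series_minus _ _ _ _
    (is_series_scal 2 _ _ (HB _ Hz2)) (HB _ Hz)).
  match goal with |- is_series _ ?a -> is_series _ ?b => replace b with a end.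
  - apply is_series_ext. intro n. unfold plus, opp, scal, mid_bern; simpl.
    unfold Hierarchy.mult; simpl.
    replace ((z / 2) ^ n) with (z ^ n / 2 ^ n)
      by (unfold Rdiv; now rewrite Rpow_mult_distr, pow_inv).
    field. split; [apply pow_nonzero; lra|apply INR_fact_neq_0].
  - unfold plus, opp, scal; simpl. unfold Hierarchy.mult; simpl.
    rewrite exp_Ropp.
    replace (exp z) with (exp (z / 2) * exp (z / 2))
      by (rewrite <- exp_plus; f_equal; field).
    field. repeat split; try lra; intro E.
    + apply He. nra.
Qed.

(** The two power series multiply to z near 0, so by uniqueness of coefficients their Cauchy product
    is the coefficient sequence of z. *)
Lemma mid_bern_conv (B : nat -> R) : bernoulli_numbers B ->
  forall n, sum_f_R0 (fun k => mid_bern B k * two_sinh_coef (n - k)) n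
            = if Nat.eqb n 1 then 1 else 0.
Proof.
  intros HB n. destruct (mid_bern_is_pseries B HB) as [r [Hr H]].
  set (e := fun n : nat => if Nat.eqb n 1 then 1 else 0).
  assert (He : forall z, is_series (fun n => e n * z ^ n) z).
  { intro z. apply is_series_Reals. intros eps Heps. exists 1%nat.
    intros m Hm. unfold Rdist.
    replace (sum_f_R0 (fun n => e n * z ^ n) m) with z;
      [rewrite Rminus_diag, Rabs_R0; lra|].
    induction m as [|m IH]; [lia|].
    destruct m as [|m]; [unfold e; simpl; ring|].
    change (sum_f_R0 (fun n => e n * z ^ n) (S (S m)))
      with (sum_f_R0 (fun n => e n * z ^ n) (S m) + e (S (S m)) * z ^ (S (S m))).
    rewrite <- IH by lia. unfold e. simpl. ring. }
  assert (C1 : Rbar_lt 0 (CV_radius (mid_bern B))).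
  { apply (CV_radius_pos _ (r / 2) _ ltac:(lra) (H (r / 2) ltac:(rewrite Rabs_pos_eq; lra))). }
  assert (C2 : forall x, Rbar_lt (Rabs x) (CV_radius two_sinh_coef)).
  { intro x. destruct (Rbar_lt_le_dec (Rabs x) (CV_radius two_sinh_coef)) as [h|h]; [exact h|].
    exfalso. pose proof (Rabs_pos x).
    apply (CV_disk_outside two_sinh_coef (Rabs x + 1)).
    - apply Rbar_le_lt_trans with (Rabs x); [exact h|].
      simpl. rewrite (Rabs_pos_eq (_ + _)); lra.
    - apply ex_series_lim_0. eexists. apply two_sinh_is_pseries. }
  assert (C3 : Rbar_lt 0 (CV_radius e)).
  { apply (CV_radius_pos e 1 _ ltac:(lra) (He 1)). }
  assert (Hprod : forall z, 0 < Rabs z < r -> Rbar_lt (Rabs z) (CV_radius (mid_bern B)) ->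
    is_pseries (PS_mult (mid_bern B) two_sinh_coef) z z).
  { intros z Hz Hc.
    assert (Hz0 : z <> 0) by (intro E; subst z; rewrite Rabs_R0 in Hz; lra).
    replace z with (z / (exp (z / 2) - exp (- (z / 2))) *
                    (exp (z / 2) - exp (- (z / 2)))) at 2.
    - apply is_pseries_mult; [| |exact Hc|apply C2]; apply is_pseries_R.
      + now apply H.
      + apply two_sinh_is_pseries.
    - field. intro E. assert (E' : exp (z / 2) = exp (- (z / 2))) by lra.
      apply exp_inv in E'. lra. }
  assert (Hr' : exists d, 0 < d /\ d < r /\ Rbar_lt d (CV_radius (mid_bern B))).
  { destruct (CV_radius (mid_bern B)) as [c| |]; simpl in *.
    - exists (Rmin (r / 2) (c / 2)).
      repeat split; unfold Rmin; destruct Rle_dec; lra.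
    - exists (r / 2). repeat split; lra.
    - contradiction. }
  destruct Hr' as [d [Hd [Hdr Hdc]]].
  assert (Hin : forall z, 0 < Rabs z <= d ->
    is_pseries (PS_mult (mid_bern B) two_sinh_coef) z z).
  { intros z Hz. apply Hprod; [lra|].
    apply Rbar_le_lt_trans with d; [simpl; lra|exact Hdc]. }
  apply (PSeries_ext_recip (PS_mult (mid_bern B) two_sinh_coef) e).
  - apply (CV_radius_pos _ d d Hd). apply is_pseries_R.
    apply Hin. rewrite Rabs_pos_eq; lra.
  - exact C3.
  - exists (mkposreal d Hd). intros z Hz.
    change (Rabs (minus z 0) < d) in Hz.
    unfold minus, plus, opp in Hz; simpl in Hz. rewrite Ropp_0, Rplus_0_r in Hz.
    transitivity z; [|symmetry; apply is_pseries_unique, is_pseries_R, He].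
    (* The generating function is only given off 0; at 0 the product vanishes because
       [two_sinh_coef 0] is 0. *)
    destruct (Req_dec z 0) as [->|Hz0].
    + rewrite PSeries_0. unfold PS_mult. simpl. unfold two_sinh_coef. simpl. field.
    + apply is_pseries_unique, Hin. split; [now apply Rabs_pos_lt|lra].
Qed.

(** This is coefficient 1 of the convolution: [two_sinh_coef] is 0 at index 0 and 1 at index 1. *)
Lemma mid_bern_0 (B : nat -> R) : bernoulli_numbers B -> mid_bern B 0 = 1.
Proof.
  intro HB. generalize (mid_bern_conv B HB 1). unfold two_sinh_coef. simpl. lra.
Qed.

(** * The midpoint Euler-Maclaurin formula *)

(* Coquelicot's lemmas state equations at [NormedModule.sort R_NormedModule];
   [ring] and [field] expect them at [R]. *)
Ltac eq_R := match goal with |- @eq _ ?a ?b => change (@eq R a b) end.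

Lemma sum_triangle_switch (u : nat -> nat -> R) (N : nat) :
  sum_f_R0 (fun k => sum_f_R0 (fun i => u k i) (N - k)) N
  = sum_f_R0 (fun n => sum_f_R0 (fun k => u k (n - k)%nat) n) N.
Proof.
  induction N as [|N IH]; [reflexivity|].
  rewrite !tech5. cbv beta. rewrite Nat.sub_diag.
  rewrite (sum_eq _ (fun k => sum_f_R0 (fun i => u k i) (N - k) + u k (S N - k)%nat)).
  2:{ intros k Hk. rewrite Nat.sub_succ_l by exact Hk. reflexivity. }
  rewrite sum_plus, IH. simpl. ring.
Qed.

Definition derivative_seq (D : nat -> R -> R) : Prop :=
  forall k y, is_derive (D k) y (D (S k) y).

(** Quadratic decay is enough for absolute convergence of the sums over midpoints. *)
Definition decays (f : R -> R) : Prop :=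
  exists C, forall y, Rabs (f y) * (1 + y ^ 2) <= C.

Lemma derivative_seq_shift (D : nat -> R -> R) (k : nat) :
  derivative_seq D -> derivative_seq (fun i => D (k + i)%nat).
Proof. intros H i y. rewrite Nat.add_succ_r. apply H. Qed.

(* The derivative in the base point of a Taylor polynomial telescopes. *)
Lemma taylor_poly_derive (D : nat -> R -> R) (b : R) (n : nat) (u : R) :
  derivative_seq D ->
  is_derive (fun u => sum_f_R0 (fun i => D i u * (b - u) ^ i / INR (fact i)) n) u
    (D (S n) u * (b - u) ^ n / INR (fact n)).
Proof.
  intro HD. induction n as [|n IH].
  - simpl. apply is_derive_ext with (D 0%nat); [intro t; eq_R; field|].
    replace (_ * 1 / 1) with (D 1%nat u) by field. apply HD.
  - simpl sum_f_R0.
    assert (Hb : is_derive (fun t : R => b - t) u (-1))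
      by (auto_derive; [exact I|ring]).
    assert (H : is_derive (fun u => D (S n) u * (b - u) ^ (S n) / INR (fact (S n))) u
      (D (S (S n)) u * (b - u) ^ (S n) / INR (fact (S n))
       - D (S n) u * (b - u) ^ n / INR (fact n))).
    { evar_last.
      - apply (is_derive_ext (fun t => / INR (fact (S n)) * (D (S n) t * (b - t) ^ S n))).
        + intro t. eq_R. unfold Rdiv. ring.
        + apply is_derive_scal. apply (is_derive_mult (D (S n)) (fun t => (b - t) ^ S n)).
          * apply HD.
          * exact (is_derive_pow (fun t => b - t) _ _ _ Hb).
          * intros; apply Rmult_comm.
      - change (/ INR (fact (S n)) * (D (S (S n)) u * (b - u) ^ S n
                  + D (S n) u * (INR (S n) * -1 * (b - u) ^ n))
          = D (S (S n)) u * (b - u) ^ S n / INR (fact (S n))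
            - D (S n) u * (b - u) ^ n / INR (fact n)).
        rewrite fact_simpl, mult_INR.
        field. split; [apply INR_fact_neq_0|apply not_0_INR; lia]. }
    generalize (is_derive_plus _ _ _ _ _ IH H). unfold plus; simpl.
    intro G. evar_last; [exact G|]. eq_R. unfold plus; simpl. ring.
Qed.

(** The mean value theorem is applied in the base point, which moves from x to x + d while the
    evaluation point x + d stays fixed. The step d may be negative, as [central_difference]
    requires, and 1/n! is bounded by 1. *)
Lemma taylor_remainder (D : nat -> R -> R) (x d M : R) (n : nat) :
  derivative_seq D ->
  (forall c, Rabs (c - x) <= Rabs d -> Rabs (D (S n) c) <= M) ->
  Rabs (D 0%nat (x + d) - sum_f_R0 (fun i => D i x * d ^ i / INR (fact i)) n)
    <= M * Rabs d ^ S n.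
Proof.
  intros HD HM.
  set (G := fun u => sum_f_R0 (fun i => D i u * (x + d - u) ^ i / INR (fact i)) n).
  destruct (MVT_gen G x (x + d)
    (fun u => D (S n) u * (x + d - u) ^ n / INR (fact n))) as [c [Hc E]].
  - intros u _. now apply taylor_poly_derive.
  - intros u _. apply derivable_continuous_pt. eexists. apply is_derive_Reals.
    now apply taylor_poly_derive.
  - assert (G1 : G (x + d) = D 0%nat (x + d)).
    { unfold G. rewrite Rminus_diag. clear. induction n as [|n IH]; simpl; [field|].
      rewrite IH. unfold Rdiv. ring. }
    assert (G0 : G x = sum_f_R0 (fun i => D i x * d ^ i / INR (fact i)) n).
    { unfold G. apply sum_eq. intros i _. now replace (x + d - x) with d by ring. }
    rewrite <- G0, <- G1, E.
    assert (Hcx : Rabs (c - x) <= Rabs d /\ Rabs (x + d - c) <= Rabs d).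
    { unfold Rmin, Rmax in Hc. split; unfold Rabs; repeat destruct Rcase_abs;
        destruct Rle_dec; lra. }
    replace (x + d - x) with d by ring.
    unfold Rdiv. rewrite !Rabs_mult, <- RPow_abs.
    assert (Hf : Rabs (/ INR (fact n)) <= 1).
    { assert (1 <= INR (fact n)) by (apply (le_INR 1); pose proof (lt_O_fact n); lia).
      rewrite Rabs_pos_eq by (left; apply Rinv_0_lt_compat; lra).
      rewrite <- Rinv_1. apply Rinv_le_contravar; lra. }
    assert (Hp : Rabs (x + d - c) ^ n <= Rabs d ^ n).
    { apply pow_incr. split; [apply Rabs_pos|apply Hcx]. }
    assert (HM' := HM c (proj1 Hcx)).
    pose proof (Rabs_pos (D (S n) c)). pose proof (Rabs_pos (/ INR (fact n))).
    assert (0 <= Rabs (x + d - c) ^ n) by (apply pow_le, Rabs_pos).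
    simpl. rewrite (Rmult_comm (Rabs d)), <- Rmult_assoc.
    apply Rmult_le_compat_r; [apply Rabs_pos|].
    rewrite <- (Rmult_1_r (M * _)).
    apply Rmult_le_compat; try assumption; [now apply Rmult_le_pos|].
    now apply Rmult_le_compat.
Qed.

(** Subtracting the Taylor expansions with steps h/2 and -h/2 produces the coefficients of 2 sinh
    (z/2); the two remainders account for the factor 2. *)
Lemma central_difference (D : nat -> R -> R) (y h M : R) (n : nat) :
  derivative_seq D -> 0 <= h ->
  (forall c, y - h / 2 <= c <= y + h / 2 -> Rabs (D (S n) c) <= M) ->
  Rabs (D 0%nat (y + h / 2) - D 0%nat (y - h / 2)
        - sum_f_R0 (fun i => D i y * (two_sinh_coef i * h ^ i)) n)
    <= 2 * M * h ^ S n.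
Proof.
  intros HD Hh HM.
  assert (HM' : forall c, Rabs (c - y) <= Rabs (h / 2) -> Rabs (D (S n) c) <= M).
  { intros c Hc. apply HM. rewrite (Rabs_pos_eq (h / 2)) in Hc by lra.
    apply Rabs_le_between in Hc. lra. }
  assert (H1 := taylor_remainder D y (h / 2) M n HD HM').
  assert (H2 := taylor_remainder D y (- (h / 2)) M n HD
    ltac:(intros c Hc; rewrite Rabs_Ropp in Hc; auto)).
  rewrite Rabs_Ropp in H2. rewrite (Rabs_pos_eq (h / 2)) in H1, H2 by lra.
  assert (HM0 : 0 <= M).
  { apply Rle_trans with (2 := HM y ltac:(lra)), Rabs_pos. }
  assert (Hp : (h / 2) ^ S n <= h ^ S n) by (apply pow_incr; lra).
  replace (sum_f_R0 (fun i => D i y * (two_sinh_coef i * h ^ i)) n)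
    with (sum_f_R0 (fun i => D i y * (h / 2) ^ i / INR (fact i)) n
          - sum_f_R0 (fun i => D i y * (- (h / 2)) ^ i / INR (fact i)) n).
  - apply Rabs_le_between in H1. apply Rabs_le_between in H2.
    apply Rabs_le_between. unfold Rminus in *.
    assert (M * (h / 2) ^ S n <= M * h ^ S n) by now apply Rmult_le_compat_l.
    lra.
  - rewrite <- minus_sum. apply sum_eq. intros i _. unfold two_sinh_coef.
    replace (- (h / 2)) with (h * - (1 / 2)) by field.
    replace (h / 2) with (h * (1 / 2)) by field.
    rewrite !Rpow_mult_distr. field. apply INR_fact_neq_0.
Qed.

(** For [g = mid_bern B] this is the operator z / (2 sinh (z/2)) at z = h d/dy, truncated after
    order N. *)
Definition em_sum (g : nat -> R) (D : nat -> R -> R) (N : nat) (h y : R) : R :=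
  sum_f_R0 (fun k => g k * h ^ k * D k y) N.

(** Formally, with z = h d/dy, the central difference is 2 sinh (z/2) and its composition with
    [em_sum] is z, that is, h times the first derivative. The term of index k is expanded to order N
    - k, so that every remainder involves [D (S N)] and [h ^ S N]. *)
Lemma em_sum_difference (g : nat -> R) (D : nat -> R -> R) (N : nat) (h y M : R) :
  (forall n, sum_f_R0 (fun k => g k * two_sinh_coef (n - k)) n
             = if Nat.eqb n 1 then 1 else 0) ->
  derivative_seq D -> (1 <= N)%nat -> 0 <= h ->
  (forall c, y - h / 2 <= c <= y + h / 2 -> Rabs (D (S N) c) <= M) ->
  Rabs (em_sum g D N h (y + h / 2) - em_sum g D N h (y - h / 2) - h * D 1%nat y)
    <= 2 * sum_f_R0 (fun k => Rabs (g k)) N * M * h ^ S N.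
Proof.
  intros g_conv HD HN Hh HM.
  replace (h * D 1%nat y) with
    (sum_f_R0 (fun k => sum_f_R0 (fun i =>
       g k * h ^ k * (D (k + i)%nat y * (two_sinh_coef i * h ^ i))) (N - k)) N).
  - unfold em_sum. rewrite <- !minus_sum.
    eapply Rle_trans; [apply sum_f_R0_triangle|].
    replace (2 * sum_f_R0 (fun k => Rabs (g k)) N * M * h ^ S N)
      with ((2 * M * h ^ S N) * sum_f_R0 (fun k => Rabs (g k)) N) by ring.
    rewrite scal_sum. apply sum_Rle. intros k Hk.
    assert (H := central_difference (fun i => D (k + i)%nat) y h M (N - k)
      (derivative_seq_shift D k HD) Hh).
    simpl in H. replace (k + S (N - k))%nat with (S N) in H by lia.
    specialize (H HM). rewrite Nat.add_0_r in H.
    rewrite <- (Rmult_1_l (sum_f_R0 (fun i => _) (N - k))).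
    rewrite <- (sum_eq (fun i => (D (k + i)%nat y * (two_sinh_coef i * h ^ i)) * (g k * h ^ k))
      (fun i => g k * h ^ k * (D (k + i)%nat y * (two_sinh_coef i * h ^ i)))) by (intros; ring).
    rewrite <- scal_sum.
    match goal with |- Rabs ?a <= _ => replace a with (g k * (h ^ k *
      (D k (y + h / 2) - D k (y - h / 2) -
       sum_f_R0 (fun i => D (k + i)%nat y * (two_sinh_coef i * h ^ i)) (N - k)))) by ring end.
    rewrite !Rabs_mult, (Rabs_pos_eq (h ^ k)) by now apply pow_le.
    apply Rmult_le_compat_l; [apply Rabs_pos|].
    apply Rle_trans with (h ^ k * (2 * M * (h * h ^ (N - k)))).
    + apply Rmult_le_compat_l; [now apply pow_le|exact H].
    + right. replace (S N) with (k + S (N - k))%nat by lia. rewrite pow_add. simpl. ring.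
  (* The terms with k + i <= N are regrouped by n = k + i; the convolution hypothesis leaves only n
     = 1. *)
  - rewrite (sum_triangle_switch (fun k i => g k * h ^ k * (D (k + i)%nat y * (two_sinh_coef i * h ^ i)))).
    rewrite (sum_eq _ (fun n => if Nat.eqb n 1 then h * D 1%nat y else 0)).
    + clear HM. induction N as [|N IH]; [lia|]. destruct N as [|N].
      * simpl. ring.
      * change (sum_f_R0 (fun n => if Nat.eqb n 1 then h * D 1%nat y else 0) (S N) + 0
                = h * D 1%nat y). rewrite IH by lia. ring.
    + intros n Hn.
      rewrite (sum_eq _ (fun k => (g k * two_sinh_coef (n - k)) * (h ^ n * D n y))).
      * rewrite <- scal_sum, g_conv. destruct (Nat.eqb_spec n 1) as [->|_]; simpl; ring.
      * intros k Hk. replace (k + (n - k))%nat with n by lia.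
        replace (h ^ n) with (h ^ k * h ^ (n - k)) by (rewrite <- pow_add; f_equal; lia).
        ring.
Qed.

Lemma is_series_telescope (u : nat -> R) :
  is_lim_seq u 0 -> is_series (fun j => u (S j) - u j) (- u 0%nat).
Proof.
  intro Hu.
  assert (H : is_lim_seq (fun n => u (S n) - u 0%nat) (- u 0%nat)).
  { replace (- u 0%nat) with (0 - u 0%nat) by ring.
    apply is_lim_seq_minus'; [now apply -> is_lim_seq_incr_1|apply is_lim_seq_const]. }
  apply is_lim_seq_ext with (2 := H). intro n. rewrite sum_n_Reals.
  induction n as [|n IH]; [reflexivity|]. rewrite tech5, <- IH. ring.
Qed.

Lemma ex_series_inv_sqr : ex_series (fun j => / (1 + INR j ^ 2)).
Proof.
  (* The majorant telescopes, and the factor 4 comes from (j + 1)(j + 2) <= 4 (1 + j^2). *)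
  apply (ex_series_le (K := R_AbsRing) (V := R_CompleteNormedModule) _
    (fun j => 4 * (/ INR (S j) - / INR (S (S j))))).
  - intro j. change (Rabs (/ (1 + INR j ^ 2)) <= 4 * (/ INR (S j) - / INR (S (S j)))).
    rewrite !S_INR. pose proof (pos_INR j).
    rewrite Rabs_pos_eq by (left; apply Rinv_0_lt_compat; nra).
    replace (4 * (/ (INR j + 1) - / (INR j + 1 + 1)))
      with (/ ((INR j + 1) * (INR j + 1 + 1) / 4)) by (field; lra).
    apply Rinv_le_contravar; nra.
  - apply (ex_series_scal (K := R_AbsRing) (V := R_NormedModule)).
    exists (- - / INR 1).
    apply is_series_ext with (fun j => - / INR (S (S j)) - - / INR (S j)); [intro; eq_R; ring|].
    apply (is_series_telescope (fun j => - / INR (S j))).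
    apply is_lim_seq_abs_0. apply is_lim_seq_ext with (fun n => / INR (S n)).
    + intro n. rewrite Rabs_Ropp, Rabs_pos_eq; [reflexivity|].
      left. apply Rinv_0_lt_compat, lt_0_INR. lia.
    + apply (is_lim_seq_incr_1 (fun n => / INR n)).
      apply (is_lim_seq_inv INR p_infty is_lim_seq_INR). discriminate.
Qed.

Lemma decays_plus (f g : R -> R) :
  decays f -> decays g -> decays (fun y => f y + g y).
Proof.
  intros [C1 H1] [C2 H2]. exists (C1 + C2). intro y.
  specialize (H1 y). specialize (H2 y). pose proof (Rabs_triang (f y) (g y)). nra.
Qed.

Lemma decays_scal (c : R) (f : R -> R) : decays f -> decays (fun y => c * f y).
Proof.
  intros [C H]. exists (Rabs c * C). intro y. rewrite Rabs_mult, Rmult_assoc.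
  apply Rmult_le_compat_l; [apply Rabs_pos|apply H].
Qed.

Lemma decays_ext (f g : R -> R) : (forall y, f y = g y) -> decays f -> decays g.
Proof. intros E [C H]. exists C. intro y. rewrite <- E. apply H. Qed.

Lemma decays_sum (u : nat -> R -> R) (N : nat) :
  (forall k, decays (u k)) -> decays (fun y => sum_f_R0 (fun k => u k y) N).
Proof.
  intro H. induction N as [|N IH]; simpl; [apply H|now apply decays_plus].
Qed.

(** For h <= 1, h^2 (1 + j^2) <= 1 + (h j)^2. The constant does not depend on h; uniformity in j
    costs a factor h^-2. *)
Lemma decays_scaled (f : R -> R) : decays f ->
  exists C, 0 <= C /\ forall h (j : nat) y, 0 < h <= 1 -> h * INR j <= y ->
    Rabs (f y) <= C / h ^ 2 * / (1 + INR j ^ 2).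
Proof.
  intros [C H]. exists C. split.
  { apply Rle_trans with (2 := H 0). pose proof (Rabs_pos (f 0)). nra. }
  intros h j y Hh Hy. pose proof (pos_INR j). specialize (H y).
  assert (Hj : h ^ 2 * (1 + INR j ^ 2) <= 1 + y ^ 2).
  { assert (0 <= h * INR j) by (apply Rmult_le_pos; lra). nra. }
  assert (0 < h ^ 2 * (1 + INR j ^ 2)) by (apply Rmult_lt_0_compat; nra).
  apply Rmult_le_reg_r with (1 := H1).
  replace (C / h ^ 2 * / (1 + INR j ^ 2) * (h ^ 2 * (1 + INR j ^ 2))) with C
    by (field; nra).
  apply Rle_trans with (2 := H). apply Rmult_le_compat_l; [apply Rabs_pos|exact Hj].
Qed.

Lemma decays_ex_series (f : R -> R) (h : R) : decays f -> 0 < h <= 1 ->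
  ex_series (fun j => f (h * (INR j + 1 / 2))).
Proof.
  intros Hf Hh. destruct (decays_scaled f Hf) as [C [_ HC]].
  apply (ex_series_le (K := R_AbsRing) (V := R_CompleteNormedModule) _
    (fun j => C / h ^ 2 * / (1 + INR j ^ 2))).
  - intro j. apply HC; [exact Hh|]. nra.
  - apply (ex_series_scal (K := R_AbsRing) (V := R_NormedModule)), ex_series_inv_sqr.
Qed.

(* Midpoint Euler-Maclaurin formula on the half-line: the left-hand sides of
   [em_sum_difference] telescope along the points [h * j]. *)
Lemma midpoint_expansion (g : nat -> R) (D : nat -> R -> R) (N : nat) :
  (forall n, sum_f_R0 (fun k => g k * two_sinh_coef (n - k)) n
             = if Nat.eqb n 1 then 1 else 0) ->
  derivative_seq D -> (forall k, decays (D k)) -> (1 <= N)%nat ->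
  exists C, forall h, 0 < h <= 1 ->
    Rabs (h * Series (fun j => D 1%nat (h * (INR j + 1 / 2))) + em_sum g D N h 0)
      <= C * h ^ (N - 1).
Proof.
  intros g_conv HD Hdec HN.
  destruct (decays_scaled _ (Hdec (S N))) as [C [HC0 HC]].
  set (A := 2 * sum_f_R0 (fun k => Rabs (g k)) N).
  assert (HA : 0 <= A).
  { apply Rmult_le_pos; [lra|]. apply cond_pos_sum. intro. apply Rabs_pos. }
  exists (A * C * Series (fun j => / (1 + INR j ^ 2))). intros h Hh.
  set (F := em_sum g D N h).
  set (r := fun j => F (h * INR (S j)) - F (h * INR j) - h * D 1%nat (h * (INR j + 1 / 2))).
  assert (Hr : forall j, Rabs (r j) <= A * C * h ^ (N - 1) * / (1 + INR j ^ 2)).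
  { intro j. unfold r.
    replace (h * INR (S j)) with (h * (INR j + 1 / 2) + h / 2) by (rewrite S_INR; field).
    replace (h * INR j) with (h * (INR j + 1 / 2) - h / 2) by field.
    (* One cell has error of order h^(N+1), and the h^-2 of [decays_scaled] lowers the exponent to N
       - 1. *)
    replace (A * C * h ^ (N - 1) * / (1 + INR j ^ 2))
      with (A * (C / h ^ 2 * / (1 + INR j ^ 2)) * h ^ S N).
    - apply em_sum_difference; try assumption; [lra|].
      intros c Hc. apply HC; [exact Hh|]. lra.
    - replace (S N) with (N - 1 + 2)%nat by lia. rewrite pow_add.
      pose proof (pos_INR j). field. split; nra. }
  (* The values of F along h j are summable, hence tend to 0: infinity contributes nothing to the
     telescoped sum and - F 0 remains. *)
  assert (HFlim : is_lim_seq (fun j => F (h * INR j)) 0).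
  { apply ex_series_lim_0.
    assert (HF : decays F).
    { apply (decays_sum (fun k y => g k * h ^ k * D k y)).
      intro k. apply decays_scal, Hdec. }
    destruct (decays_scaled F HF) as [C' [_ HC']].
    apply (ex_series_le (K := R_AbsRing) (V := R_CompleteNormedModule) _
      (fun j => C' / h ^ 2 * / (1 + INR j ^ 2))).
    - intro j. apply HC'; [exact Hh|lra].
    - apply (ex_series_scal (K := R_AbsRing) (V := R_NormedModule)), ex_series_inv_sqr. }
  assert (Hmaj : ex_series (fun j => A * C * h ^ (N - 1) * / (1 + INR j ^ 2))).
  { apply (ex_series_scal (K := R_AbsRing) (V := R_NormedModule)), ex_series_inv_sqr. }
  assert (Hrabs : ex_series (fun j => Rabs (r j))).
  { apply (ex_series_le (K := R_AbsRing) (V := R_CompleteNormedModule)) with (2 := Hmaj).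
    intro j. change (Rabs (Rabs (r j)) <= A * C * h ^ (N - 1) * / (1 + INR j ^ 2)).
    rewrite Rabs_Rabsolu. apply Hr. }
  assert (Hs : is_series (fun j => h * D 1%nat (h * (INR j + 1 / 2)))
                 (- F 0 - Series r)).
  { generalize (is_series_minus _ _ _ _ (is_series_telescope _ HFlim)
      (Series_correct r (ex_series_Rabs _ Hrabs))).
    replace (h * INR 0) with 0 by (simpl; ring).
    apply is_series_ext. intro j. eq_R.
    change (F (h * INR (S j)) - F (h * INR j) - r j = h * D 1%nat (h * (INR j + 1 / 2))).
    unfold r. ring. }
  rewrite <- Series_scal_l, (is_series_unique _ _ Hs).
  change (em_sum g D N h 0) with (F 0).
  replace (- F 0 - Series r + F 0) with (- Series r) by ring.
  rewrite Rabs_Ropp. eapply Rle_trans; [now apply Series_Rabs|].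
  replace (A * C * Series (fun j => / (1 + INR j ^ 2)) * h ^ (N - 1))
    with (Series (fun j => A * C * h ^ (N - 1) * / (1 + INR j ^ 2))).
  - apply Series_le with (2 := Hmaj). intro j. split; [apply Rabs_pos|apply Hr].
  - rewrite Series_scal_l. ring.
Qed.

(** * Derivatives of Gaussian monomials *)

(* The k-th derivative of [y ^ m * exp (- y ^ 2)]; at [m = 0] the junk index
   [m - 1] is multiplied by [0]. *)
Fixpoint gauss_deriv (k m : nat) (y : R) : R :=
  match k with
  | O => y ^ m * exp (- y ^ 2)
  | S k => INR m * gauss_deriv k (m - 1) y - 2 * gauss_deriv k (m + 1) y
  end.

Lemma gauss_deriv_is_derive (m : nat) : derivative_seq (fun k => gauss_deriv k m).
Proof.
  intro k. revert m. induction k as [|k IH]; intros m y.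
  - simpl gauss_deriv. auto_derive; [exact I|].
    rewrite Nat.sub_1_r, pow_add. ring.
  - change (is_derive (fun y => INR m * gauss_deriv k (m - 1) y - 2 * gauss_deriv k (m + 1) y) y
      (INR m * gauss_deriv (S k) (m - 1) y - 2 * gauss_deriv (S k) (m + 1) y)).
    apply (is_derive_minus (fun y => INR m * gauss_deriv k (m - 1) y)
      (fun y => 2 * gauss_deriv k (m + 1) y)); apply is_derive_scal, IH.
Qed.

(** For k = 0 put w = 1 + y^2: then |y|^m w <= w^(m+1) <= (m+1)! exp w, while exp (- y^2) = e / exp
    w. The recurrence carries the bound to higher derivatives. *)
Lemma gauss_deriv_decays (k m : nat) : decays (gauss_deriv k m).
Proof.
  revert m. induction k as [|k IH]; intro m.
  - exists (INR (fact (S m)) * exp 1). intro y.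
    change (gauss_deriv 0 m y) with (y ^ m * exp (- y ^ 2)).
    rewrite Rabs_mult, (Rabs_pos_eq (exp _)) by (left; apply exp_pos).
    set (w := 1 + y ^ 2).
    assert (Hw : Rabs y <= w /\ 1 <= w).
    { unfold w, Rabs. destruct Rcase_abs; nra. }
    assert (Hp : Rabs (y ^ m) <= w ^ m).
    { rewrite <- RPow_abs. apply pow_incr. split; [apply Rabs_pos|apply Hw]. }
    assert (He : w ^ S m <= INR (fact (S m)) * exp w).
    { pose proof (exp_ge_taylor w (S m) ltac:(lra)) as H. rewrite tech5 in H.
      assert (0 <= sum_f_R0 (fun k => w ^ k / INR (fact k)) m).
      { apply cond_pos_sum. intro i. apply Rdiv_le_0_compat; [apply pow_le; lra|].
        apply INR_fact_lt_0. }
      pose proof (INR_fact_lt_0 (S m)).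
      replace (w ^ S m) with (INR (fact (S m)) * (w ^ S m / INR (fact (S m))))
        by (field; lra).
      apply Rmult_le_compat_l; lra. }
    replace (exp (- y ^ 2)) with (exp 1 * / exp w)
      by (unfold w; rewrite <- exp_Ropp, <- exp_plus; f_equal; ring).
    apply Rle_trans with (w ^ m * (exp 1 * / exp w) * w).
    + apply Rmult_le_compat_r; [lra|]. apply Rmult_le_compat_r; [|exact Hp].
      left. apply Rmult_lt_0_compat; [|apply Rinv_0_lt_compat]; apply exp_pos.
    + pose proof (exp_pos w). pose proof (exp_pos 1).
      replace (w ^ m * (exp 1 * / exp w) * w) with (w ^ S m * (exp 1 * / exp w))
        by (simpl; ring).
      replace (INR (fact (S m)) * exp 1)
        with (INR (fact (S m)) * exp w * (exp 1 * / exp w)) by (field; lra).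
      apply Rmult_le_compat_r; [|exact He].
      left. apply Rmult_lt_0_compat; [lra|apply Rinv_0_lt_compat; lra].
  - apply (decays_ext (fun y => INR m * gauss_deriv k (m - 1) y + (-2) * gauss_deriv k (m + 1) y)).
    + intro y. simpl. ring.
    + apply decays_plus; apply decays_scal, IH.
Qed.

(** The recurrence preserves the parity of k + m, and y^m vanishes at 0 for odd m. *)
Lemma gauss_deriv_0_odd (k m : nat) :
  Nat.even (k + m) = false -> gauss_deriv k m 0 = 0.
Proof.
  revert m. induction k as [|k IH]; intros m H.
  - destruct m; [discriminate|]. simpl. ring.
  - simpl. rewrite (IH (m + 1)%nat) by now rewrite Nat.add_1_r, Nat.add_succ_r.
    destruct m as [|m]; [simpl; ring|].
    rewrite (IH (S m - 1)%nat); [ring|].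
    simpl in H. rewrite Nat.add_succ_r in H. simpl. now rewrite Nat.sub_0_r.
Qed.

Lemma gauss_deriv_0_lt (k m : nat) : (k < m)%nat -> gauss_deriv k m 0 = 0.
Proof.
  revert m. induction k as [|k IH]; intros m H; simpl.
  - rewrite pow_i by lia. ring.
  - rewrite !IH by lia. ring.
Qed.

(** The Taylor coefficient of y^(m+2r) in y^m exp (- y^2) is (-1)^r / r!. In the induction the two
    terms of the recurrence combine through m + 2 r = k + 1. *)
Lemma gauss_deriv_0_even (r m : nat) :
  gauss_deriv (m + 2 * r) m 0 = (-1) ^ r * INR (fact (m + 2 * r)) / INR (fact r).
Proof.
  remember (m + 2 * r)%nat as k eqn:Ek. revert m r Ek.
  induction k as [|k IH]; intros m r Ek.
  - assert (m = 0%nat) by lia. assert (r = 0%nat) by lia. subst. simpl.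
    replace (- (0 * (0 * 1))) with 0 by ring. rewrite exp_0. field.
  - simpl gauss_deriv.
    assert (E1 : INR m * gauss_deriv k (m - 1) 0
      = INR m * ((-1) ^ r * INR (fact k) / INR (fact r))).
    { destruct m as [|m]; [simpl; ring|]. rewrite (IH _ r) by lia. reflexivity. }
    rewrite E1.
    assert (HS : INR (fact (S k)) = (INR m + 2 * INR r) * INR (fact k)).
    { rewrite fact_simpl, mult_INR, Ek, plus_INR, mult_INR. simpl. ring. }
    rewrite HS. pose proof (INR_fact_neq_0 r).
    (* For r = 0 the second term of the recurrence has derivative order below its exponent and
       vanishes. *)
    destruct r as [|r].
    + rewrite gauss_deriv_0_lt by lia. simpl. field.
    + rewrite (IH (m + 1)%nat r) by lia.
      rewrite (fact_simpl r), mult_INR. pose proof (INR_fact_neq_0 r).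
      assert (INR (S r) <> 0) by (apply not_0_INR; lia).
      simpl pow. field. now split.
Qed.

(* The antiderivative of [y ^ (2 * m + 1) * exp (- y ^ 2)] vanishing at
   infinity. *)
Fixpoint gauss_prim (m : nat) (y : R) : R :=
  match m with
  | O => - (1 / 2) * gauss_deriv 0 0 y
  | S m => - (1 / 2) * gauss_deriv 0 (2 * S m) y + INR (S m) * gauss_prim m y
  end.

(** Index 0 is the antiderivative, so that index 1 is the function summed over the midpoints in
    [midpoint_expansion]. *)
Definition gauss_prim_deriv (m k : nat) (y : R) : R :=
  match k with O => gauss_prim m y | S k => gauss_deriv k (2 * m + 1) y end.

(** The recursion of [gauss_prim] is integration by parts, y exp (- y^2) being the derivative of -
    exp (- y^2) / 2. *)
Lemma gauss_prim_deriv_is_derive (m : nat) : derivative_seq (gauss_prim_deriv m).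
Proof.
  intros [|k] y; [|apply gauss_deriv_is_derive].
  simpl gauss_prim_deriv. induction m as [|m IH].
  - simpl gauss_prim. evar_last.
    + apply is_derive_scal, (gauss_deriv_is_derive 0 0%nat).
    + simpl. field.
  - cbn [gauss_prim]. evar_last.
    + apply (is_derive_plus (fun y => - (1 / 2) * gauss_deriv 0 (2 * S m) y)
        (fun y => INR (S m) * gauss_prim m y)); apply is_derive_scal; [|exact IH].
      apply (gauss_deriv_is_derive (2 * S m) 0%nat).
    + change (- (1 / 2) * (INR (2 * S m) * gauss_deriv 0 (2 * S m - 1) y
                - 2 * gauss_deriv 0 (2 * S m + 1) y)
        + INR (S m) * gauss_deriv 0 (2 * m + 1) y = gauss_deriv 0 (2 * S m + 1) y).
      replace (2 * S m - 1)%nat with (2 * m + 1)%nat by lia.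
      rewrite mult_INR. change (INR 2) with 2. field.
Qed.

Lemma gauss_prim_deriv_decays (m k : nat) : decays (gauss_prim_deriv m k).
Proof.
  destruct k as [|k]; [|apply gauss_deriv_decays]. simpl.
  induction m as [|m IH].
  - apply (decays_scal _ (gauss_deriv 0 0)), gauss_deriv_decays.
  - apply (decays_plus (fun y => - (1 / 2) * gauss_deriv 0 (2 * S m) y)
      (fun y => INR (S m) * gauss_prim m y)); apply decays_scal;
      [apply gauss_deriv_decays|exact IH].
Qed.

(** The value is minus the integral of y^(2m+1) exp (- y^2) over the half-line, which is Gamma (m+1)
    / 2. *)
Lemma gauss_prim_0 (m : nat) : gauss_prim m 0 = - (INR (fact m) / 2).
Proof.
  induction m as [|m IH].
  - simpl. replace (- (0 * (0 * 1))) with 0 by ring. rewrite exp_0. field.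
  - cbn [gauss_prim]. rewrite IH, gauss_deriv_0_lt by lia.
    rewrite fact_simpl, mult_INR. field.
Qed.

(** * Asymptotic expansions at 0+ *)

Fixpoint trunc (a : nat -> R) (N : nat) (t : R) : R :=
  match N with
  | O => 0
  | S N => trunc a N t + a N * t ^ N
  end.

(** Here N counts the terms kept, so the error is of the order of the first omitted power. The
    little-o condition of [heat_invariants] at index n is compared with this bound at [S n]. *)
Definition asym (N : nat) (f : R -> R) (a : nat -> R) : Prop :=
  exists C d, 0 < d /\ forall t, 0 < t < d -> Rabs (f t - trunc a N t) <= C * t ^ N.

Lemma trunc_sum (a : nat -> R) (N : nat) (t : R) :
  trunc a (S N) t = sum_f_R0 (fun n => a n * t ^ n) N.
Proof.
  induction N as [|N IH]; [simpl; ring|]. rewrite tech5, <- IH. reflexivity.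
Qed.

Lemma trunc_ext (a b : nat -> R) (N : nat) (t : R) :
  (forall n, (n < N)%nat -> a n = b n) -> trunc a N t = trunc b N t.
Proof.
  intro E. induction N as [|N IH]; [reflexivity|]. simpl. rewrite IH, E; auto with arith.
Qed.

Lemma trunc_S (a : nat -> R) (N : nat) (t : R) :
  trunc a (S N) t = a 0%nat + t * trunc (fun n => a (S n)) N t.
Proof. induction N as [|N IH]; simpl in *; [ring|]. rewrite IH. ring. Qed.

Lemma asym_ext (N : nat) (f g : R -> R) (a b : nat -> R) :
  (forall t, 0 < t < 1 -> f t = g t) -> (forall n, (n < N)%nat -> a n = b n) ->
  asym N f a -> asym N g b.
Proof.
  intros E E' [C [d [Hd H]]]. exists C, (Rmin d 1). split; [apply Rmin_pos; lra|].
  intros t Ht. pose proof (Rmin_l d 1). pose proof (Rmin_r d 1).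
  rewrite <- E, <- (trunc_ext a b N t E') by lra. apply H. lra.
Qed.

Lemma asym_plus (N : nat) (f g : R -> R) (a b : nat -> R) :
  asym N f a -> asym N g b -> asym N (fun t => f t + g t) (fun n => a n + b n).
Proof.
  intros [C1 [d1 [Hd1 H1]]] [C2 [d2 [Hd2 H2]]].
  exists (C1 + C2), (Rmin d1 d2). split; [now apply Rmin_pos|]. intros t [Ht Ht'].
  pose proof (Rmin_l d1 d2). pose proof (Rmin_r d1 d2).
  specialize (H1 t ltac:(lra)). specialize (H2 t ltac:(lra)).
  replace (f t + g t - trunc (fun n => a n + b n) N t)
    with ((f t - trunc a N t) + (g t - trunc b N t)).
  - eapply Rle_trans; [apply Rabs_triang|]. lra.
  - replace (trunc (fun n => a n + b n) N t) with (trunc a N t + trunc b N t); [ring|].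
    clear. induction N as [|N IH]; simpl; [ring|]. rewrite <- IH. ring.
Qed.

Lemma asym_scal (N : nat) (c : R) (f : R -> R) (a : nat -> R) :
  asym N f a -> asym N (fun t => c * f t) (fun n => c * a n).
Proof.
  intros [C [d [Hd H]]]. exists (Rabs c * C), d. split; [exact Hd|]. intros t Ht.
  replace (c * f t - trunc (fun n => c * a n) N t) with (c * (f t - trunc a N t)).
  - rewrite Rabs_mult, Rmult_assoc. apply Rmult_le_compat_l; [apply Rabs_pos|now apply H].
  - replace (trunc (fun n => c * a n) N t) with (c * trunc a N t); [ring|].
    clear. induction N as [|N IH]; simpl; [ring|]. rewrite <- IH. ring.
Qed.

Lemma asym_sum (N M : nat) (f : nat -> R -> R) (a : nat -> nat -> R) :
  (forall s, (s <= M)%nat -> asym N (f s) (a s)) ->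
  asym N (fun t => sum_f_R0 (fun s => f s t) M) (fun n => sum_f_R0 (fun s => a s n) M).
Proof.
  intro H. induction M as [|M IH]; simpl; [now apply H|].
  apply asym_plus; [apply IH; intros s Hs; apply H; lia|now apply H].
Qed.

(** Peeling off the constant term reduces products to inductions on the order, without double
    sums. *)
Lemma asym_S (N : nat) (f : R -> R) (a : nat -> R) :
  asym (S N) f a <-> asym N (fun t => (f t - a 0%nat) / t) (fun n => a (S n)).
Proof.
  assert (E : forall t, 0 < t ->
    Rabs (f t - trunc a (S N) t)
    = t * Rabs ((f t - a 0%nat) / t - trunc (fun n => a (S n)) N t)).
  { intros t Ht. rewrite trunc_S.
    rewrite <- (Rabs_pos_eq t) at 4 by lra. rewrite <- Rabs_mult. f_equal. field. lra. }
  split; intros [C [d [Hd H]]]; exists C, d; (split; [exact Hd|]); intros t Ht;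
    specialize (H t Ht).
  - rewrite E in H by lra. apply Rmult_le_reg_l with t; [lra|]. simpl in H. lra.
  - rewrite E by lra. replace (C * t ^ S N) with (t * (C * t ^ N)) by (simpl; ring).
    apply Rmult_le_compat_l; lra.
Qed.

Lemma asym_pred (N : nat) (f : R -> R) (a : nat -> R) : asym (S N) f a -> asym N f a.
Proof.
  intros [C [d [Hd H]]]. exists (Rabs C + Rabs (a N)), (Rmin d 1).
  split; [apply Rmin_pos; lra|]. intros t Ht.
  pose proof (Rmin_l d 1). pose proof (Rmin_r d 1).
  specialize (H t ltac:(lra)). simpl in H.
  assert (Hp : 0 <= t ^ N) by (apply pow_le; lra).
  replace (f t - trunc a N t)
    with ((f t - (trunc a N t + a N * t ^ N)) + a N * t ^ N) by ring.
  eapply Rle_trans; [apply Rabs_triang|].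
  rewrite Rabs_mult, (Rabs_pos_eq (t ^ N)), Rmult_plus_distr_r by exact Hp.
  apply Rplus_le_compat_r. apply Rle_trans with (1 := H).
  pose proof (Rle_abs C). pose proof (Rabs_pos C).
  apply Rle_trans with (Rabs C * (t * t ^ N)).
  - apply Rmult_le_compat_r; [apply Rmult_le_pos; lra|assumption].
  - apply Rmult_le_compat_l; [assumption|]. nra.
Qed.

(** Induction through f g = a_0 g + t ((f - a_0) / t) g: the quotient (f - a_0) / t has the shifted
    coefficients and one order less. *)
Lemma asym_mult (N : nat) (f g : R -> R) (a b : nat -> R) :
  asym N f a -> asym N g b ->
  asym N (fun t => f t * g t) (fun n => sum_f_R0 (fun k => a k * b (n - k)%nat) n).
Proof.
  revert f a. induction N as [|N IH]; intros f a Hf Hg.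
  - destruct Hf as [C1 [d1 [Hd1 H1]]]. destruct Hg as [C2 [d2 [Hd2 H2]]].
    exists (C1 * C2), (Rmin d1 d2). split; [now apply Rmin_pos|]. intros t Ht.
    pose proof (Rmin_l d1 d2). pose proof (Rmin_r d1 d2).
    specialize (H1 t ltac:(lra)). specialize (H2 t ltac:(lra)). simpl in *.
    rewrite Rminus_0_r, Rabs_mult, Rmult_1_r in *.
    apply Rmult_le_compat; try apply Rabs_pos; assumption.
  - assert (H0 : asym N (fun t => (f t - a 0%nat) / t * g t)
      (fun n => sum_f_R0 (fun k => a (S k) * b (n - k)%nat) n)).
    { apply (IH _ (fun n => a (S n))); [now apply asym_S|now apply asym_pred]. }
    assert (H1 : asym (S N) (fun t => a 0%nat * g t) (fun n => a 0%nat * b n))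
      by now apply asym_scal.
    apply asym_S in H1. apply asym_S. generalize (asym_plus _ _ _ _ _ H0 H1).
    apply asym_ext.
    + intros t Ht. simpl. field. lra.
    + intros n _. rewrite (decomp_sum _ (S n)) by lia. simpl. ring.
Qed.

Lemma asym_mult_pow (N s : nat) (f : R -> R) (a : nat -> R) :
  asym N f a ->
  asym N (fun t => t ^ s * f t) (fun n => if (n <? s)%nat then 0 else a (n - s)%nat).
Proof.
  intro H. induction s as [|s IH].
  - revert H. apply asym_ext; [intros; simpl; ring|]. intros n _. now rewrite Nat.sub_0_r.
  - apply asym_pred, asym_S. revert IH. apply asym_ext.
    + intros t Ht. simpl. field. lra.
    + intros n _. reflexivity.
Qed.

Lemma asym_exp (N : nat) (c : R) :
  asym N (fun t => exp (c * t)) (fun n => c ^ n / INR (fact n)).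
Proof.
  (* The Taylor polynomial of degree N has N + 1 terms, so [taylor_remainder] proves order [S N],
     one more than needed. *)
  apply asym_pred. exists (Rabs c ^ S N * exp (Rabs c)), 1. split; [lra|]. intros t Ht.
  set (D := fun (k : nat) (y : R) => c ^ k * exp (c * y)).
  assert (HD : derivative_seq D).
  { intros k y. unfold D. auto_derive; [exact I|]. simpl. ring. }
  assert (HM : forall u, Rabs (u - 0) <= Rabs t ->
    Rabs (D (S N) u) <= Rabs c ^ S N * exp (Rabs c)).
  { intros u Hu. unfold D. rewrite Rabs_mult, <- RPow_abs.
    apply Rmult_le_compat_l; [apply pow_le, Rabs_pos|].
    rewrite Rabs_pos_eq by (left; apply exp_pos).
    assert (exp_le : forall v w, v <= w -> exp v <= exp w).
    { intros v w [Hvw|<-]; [left; now apply exp_increasing|lra]. }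
    apply exp_le. apply Rle_trans with (1 := Rle_abs _). rewrite Rabs_mult.
    rewrite Rminus_0_r, (Rabs_pos_eq t) in Hu by lra. pose proof (Rabs_pos c). nra. }
  generalize (taylor_remainder D 0 t _ N HD HM).
  rewrite (Rabs_pos_eq t) by lra. rewrite trunc_sum.
  replace (D 0%nat (0 + t)) with (exp (c * t))
    by (unfold D; rewrite Rplus_0_l; simpl; ring).
  rewrite (sum_eq (fun i => D i 0 * t ^ i / INR (fact i))
    (fun n => c ^ n / INR (fact n) * t ^ n)); [easy|].
  intros i _. unfold D. rewrite Rmult_0_r, exp_0. unfold Rdiv. ring.
Qed.

Lemma powerRZ_sub (t : R) (n m : nat) : t <> 0 ->
  powerRZ t (Z.of_nat n - Z.of_nat m) = t ^ n / t ^ m.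
Proof.
  intro Ht. unfold Z.sub. rewrite powerRZ_add by exact Ht.
  rewrite powerRZ_neg', <- !pow_powerRZ. reflexivity.
Qed.

(** By strong induction the expansions agree below index n; dividing their difference by t^n leaves
    a_n - b_n, which must then tend to 0. *)
Lemma heat_invariants_unique (nu : nat) (a b : nat -> R) :
  heat_invariants nu a ->
  (forall N, asym N (fun t => t ^ nu * heat_trace nu t) b) ->
  forall n, a n = b n.
Proof.
  intros Ha Hb n. induction n as [n IH] using lt_wf_ind.
  destruct (Hb (S n)) as [C [d [Hd H]]].
  specialize (Ha n).
  destruct (Req_dec (a n) (b n)) as [E|NE]; [exact E|exfalso].
  set (e := Rabs (a n - b n) / 2).
  assert (He : 0 < e).
  { unfold e. assert (0 < Rabs (a n - b n)) by (apply Rabs_pos_lt; lra). lra. }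
  (* Near 0+ both errors fall below e, half the supposed gap between a_n and b_n, which is absurd;
     the filter is proper, so this contradicts its existence. *)
  assert (P : at_right 0 (fun _ : R => False)).
  { assert (F1 := proj1 (filterlim_locally _ _) Ha (mkposreal e He)).
    assert (HC : 0 < e / (Rabs C + 1)).
    { apply Rdiv_lt_0_compat; [exact He|]. pose proof (Rabs_pos C). lra. }
    assert (F2 : at_right 0 (fun t => 0 < t < d /\ C * t < e)).
    { exists (mkposreal _ (Rmin_pos _ _ Hd HC)). intros t Ht Ht0.
      change (Rabs (minus t 0) < Rmin d (e / (Rabs C + 1))) in Ht.
      unfold minus, plus, opp in Ht. simpl in Ht.
      pose proof (Rmin_l d (e / (Rabs C + 1))). pose proof (Rmin_r d (e / (Rabs C + 1))).
      apply Rabs_lt_between in Ht. split; [lra|].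
      pose proof (Rabs_pos C). pose proof (Rle_abs C).
      assert (Ht' : t < e / (Rabs C + 1)) by lra.
      apply (Rmult_lt_compat_r (Rabs C + 1)) in Ht'; [|lra].
      unfold Rdiv in Ht'. rewrite Rmult_assoc, Rinv_l, Rmult_1_r in Ht' by lra. nra. }
    generalize (filter_and _ _ F1 F2). apply filter_imp.
    intros t [G1 [Ht G2]]. unfold ball in G1. simpl in G1.
    unfold AbsRing_ball, abs, minus, plus, opp in G1. simpl in G1.
    rewrite Ropp_0, Rplus_0_r in G1.
    assert (Hn : t ^ n <> 0) by (apply pow_nonzero; lra).
    assert (Hnu : t ^ nu <> 0) by (apply pow_nonzero; lra).
    specialize (H t Ht).
    rewrite powerRZ_sub, sum_n_Reals in G1 by lra.
    rewrite (sum_eq _ (fun k => a k * t ^ k * / t ^ nu)) in G1.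
    2:{ intros k _. rewrite powerRZ_sub by lra. unfold Rdiv. ring. }
    rewrite <- scal_sum, <- trunc_sum in G1. simpl trunc in G1, H.
    rewrite (trunc_ext a b n t IH) in G1.
    assert (Hnp : 0 < t ^ n) by (apply pow_lt; lra).
    set (X := t ^ nu * heat_trace nu t - (trunc b n t + b n * t ^ n)) in H.
    replace ((heat_trace nu t - / t ^ nu * (trunc b n t + a n * t ^ n)) / (t ^ n / t ^ nu))
      with (X / t ^ n - (a n - b n)) in G1 by (unfold X; field; now split).
    assert (HX : Rabs (X / t ^ n) <= C * t).
    { unfold Rdiv. rewrite Rabs_mult, (Rabs_pos_eq (/ t ^ n))
        by (left; now apply Rinv_0_lt_compat).
      apply Rmult_le_reg_r with (t ^ n); [exact Hnp|]. rewrite Rmult_assoc, Rinv_l by exact Hn.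
      simpl in H. lra. }
    assert (Rabs (a n - b n) <= Rabs (X / t ^ n) + Rabs (X / t ^ n - (a n - b n))).
    { replace (a n - b n) with (X / t ^ n + - (X / t ^ n - (a n - b n))) at 1 by ring.
      eapply Rle_trans; [apply Rabs_triang|]. rewrite Rabs_Ropp. lra. }
    unfold e in *. lra. }
  now apply filter_not_empty in P.
Qed.

(** * Heat trace of the sphere *)

Definition half_term (m : nat) (t : R) (j : nat) : R :=
  (INR j + 1 / 2) ^ (2 * m + 1) * exp (- t * (INR j + 1 / 2) ^ 2).

Lemma gauss_deriv_half_term (m j : nat) (h : R) :
  gauss_deriv 0 (2 * m + 1) (h * (INR j + 1 / 2))
  = h ^ (2 * m + 1) * half_term m (h ^ 2) j.
Proof.
  unfold half_term.
  change ((h * (INR j + 1 / 2)) ^ (2 * m + 1) * exp (- (h * (INR j + 1 / 2)) ^ 2)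
    = h ^ (2 * m + 1) * ((INR j + 1 / 2) ^ (2 * m + 1) * exp (- h ^ 2 * (INR j + 1 / 2) ^ 2))).
  rewrite !Rpow_mult_distr, Rmult_assoc, Ropp_mult_distr_l. reflexivity.
Qed.

Lemma sqrt_bounds (t : R) : 0 < t < 1 -> 0 < sqrt t <= 1 /\ sqrt t ^ 2 = t.
Proof.
  intro Ht. split; [split; [apply sqrt_lt_R0; lra|]|apply pow2_sqrt; lra].
  rewrite <- sqrt_1. apply sqrt_le_1; lra.
Qed.

Lemma half_term_ex_series (m : nat) (t : R) : 0 < t < 1 -> ex_series (half_term m t).
Proof.
  intro Ht. destruct (sqrt_bounds t Ht) as [Hh Eh]. set (h := sqrt t) in *.
  assert (Hp : h ^ (2 * m + 1) <> 0) by (apply pow_nonzero; lra).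
  apply ex_series_ext with (fun j =>
    scal (/ h ^ (2 * m + 1)) (gauss_deriv 0 (2 * m + 1) (h * (INR j + 1 / 2)))).
  - intro j. rewrite gauss_deriv_half_term, Eh.
    change (/ h ^ (2 * m + 1) * (h ^ (2 * m + 1) * half_term m t j) = half_term m t j).
    field. exact Hp.
  - apply (ex_series_scal (K := R_AbsRing) (V := R_NormedModule)).
    apply decays_ex_series; [apply gauss_deriv_decays|exact Hh].
Qed.

Lemma sum_odd_vanish (u : nat -> R) (N : nat) :
  (forall p, u (2 * p + 1)%nat = 0) ->
  sum_f_R0 u (2 * N + 1) = sum_f_R0 (fun p => u (2 * p)%nat) N.
Proof.
  intro H. induction N as [|N IH].
  - specialize (H 0%nat). simpl in *. rewrite H. ring.
  - rewrite tech5, <- IH. replace (2 * S N + 1)%nat with (S (S (2 * N + 1))) by lia.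
    rewrite !tech5. replace (S (S (2 * N + 1))) with (2 * S N + 1)%nat by lia.
    rewrite H. replace (S (2 * N + 1)) with (2 * S N)%nat by lia. ring.
Qed.

(* Where [-2] comes from: [t ^ (m + 1) * Series (half_term m t)] is expanded by
   [- em_sum] at step [h = sqrt t] and endpoint [0]. *)
Definition half_coef (B : nat -> R) (m p : nat) : R :=
  - 2 * mid_bern B (2 * p) * gauss_prim_deriv m (2 * p) 0.

(** At h = sqrt t the Euler-Maclaurin expansion is a priori in powers of h; its odd powers vanish by
    parity of the derivatives at 0, which leaves powers of t. *)
Lemma half_term_asym (B : nat -> R) (m N : nat) : bernoulli_numbers B ->
  asym N (fun t => 2 * t ^ (m + 1) * Series (half_term m t)) (half_coef B m).
Proof.
  intro HB.
  (* Order 2 N + 1 leaves an error h^(2N) = t^N. *)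
  destruct (midpoint_expansion (mid_bern B) (gauss_prim_deriv m) (2 * N + 1)
    (mid_bern_conv B HB) (gauss_prim_deriv_is_derive m)
    (gauss_prim_deriv_decays m) ltac:(lia)) as [C HC].
  (* The sum up to 2 N + 1 also contains the term of index N, which [trunc] at N omits; it is moved
     into the error. *)
  exists (2 * C + Rabs (half_coef B m N)), 1. split; [lra|]. intros t Ht.
  destruct (sqrt_bounds t Ht) as [Hh Eh]. set (h := sqrt t) in *.
  specialize (HC h Hh). replace (2 * N + 1 - 1)%nat with (2 * N)%nat in HC by lia.
  rewrite pow_mult, Eh in HC.
  rewrite (Series_ext _ (fun j => h ^ (2 * m + 1) * half_term m t j)) in HC.
  2:{ intro j. cbn [gauss_prim_deriv]. rewrite gauss_deriv_half_term, Eh. reflexivity. }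
  rewrite Series_scal_l in HC.
  assert (Et : trunc (half_coef B m) (S N) t
    = -2 * em_sum (mid_bern B) (gauss_prim_deriv m) (2 * N + 1) h 0).
  { rewrite trunc_sum. unfold em_sum. rewrite sum_odd_vanish.
    - rewrite scal_sum. apply sum_eq. intros p _. unfold half_coef.
      rewrite pow_mult, Eh. ring.
    - intro p. rewrite Nat.add_1_r. cbn [gauss_prim_deriv].
      rewrite gauss_deriv_0_odd; [ring|].
      replace (2 * p + (2 * m + 1))%nat with (S (2 * (p + m))) by lia.
      rewrite Nat.even_succ, Nat.odd_mul. reflexivity. }
  simpl trunc in Et.
  replace (2 * t ^ (m + 1) * Series (half_term m t) - trunc (half_coef B m) N t)
    with (2 * (h * (h ^ (2 * m + 1) * Series (half_term m t))
               + em_sum (mid_bern B) (gauss_prim_deriv m) (2 * N + 1) h 0)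
          + half_coef B m N * t ^ N).
  - assert (0 <= t ^ N) by (apply pow_le; lra).
    eapply Rle_trans; [apply Rabs_triang|].
    rewrite !(Rabs_mult _ (t ^ N)), (Rabs_mult 2), (Rabs_pos_eq 2), (Rabs_pos_eq (t ^ N)) by lra.
    lra.
  - replace (h * (h ^ (2 * m + 1) * Series (half_term m t)))
      with (t ^ (m + 1) * Series (half_term m t)); [lra|].
    rewrite <- Eh, <- pow_mult. replace (2 * (m + 1))%nat with (S (2 * m + 1)) by lia.
    simpl. ring.
Qed.

Lemma Series_sum_f_R0 (u : nat -> nat -> R) (M : nat) :
  (forall s, ex_series (u s)) ->
  ex_series (fun j => sum_f_R0 (fun s => u s j) M) /\
  Series (fun j => sum_f_R0 (fun s => u s j) M) = sum_f_R0 (fun s => Series (u s)) M.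
Proof.
  intro H. induction M as [|M [IH1 IH2]]; [split; [apply H|reflexivity]|].
  simpl. split; [now apply (ex_series_plus (K := R_AbsRing) (V := R_NormedModule))|].
  now rewrite Series_plus, IH2.
Qed.

Lemma prod_lt_root (f : nat -> R) (n j : nat) : (j < n)%nat -> f j = 0 -> prod_lt f n = 0.
Proof.
  intros Hj E. induction n as [|n IH]; [lia|]. simpl.
  destruct (Nat.eq_dec j n) as [->|NE]; [rewrite E; ring|]. rewrite IH by lia. ring.
Qed.

(** Each factor is (L - i)(L + i + 1), so the product is the ratio (L + i)! / (L - i)!. *)
Lemma prod_lt_half_int (L i : nat) : (i <= L)%nat ->
  prod_lt (fun i => (INR L + 1 / 2) ^ 2 - (INR i + 1 / 2) ^ 2) i * INR (fact (L - i))
  = INR (fact (L + i)).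
Proof.
  induction i as [|i IH]; intro Hi.
  - simpl prod_lt. rewrite Nat.sub_0_r, Nat.add_0_r. ring.
  - rewrite Nat.add_succ_r, (fact_simpl (L + i)), mult_INR, <- IH by lia.
    replace (L - i)%nat with (S (L - S i)) by lia.
    rewrite (fact_simpl (L - S i)), mult_INR. simpl prod_lt.
    replace (S (L - S i)) with (L - i)%nat by lia.
    rewrite minus_INR, S_INR, plus_INR by lia. field.
Qed.

Lemma mult_eq_prod (M k : nat) :
  Defs.mult (S M) k = 2 / INR (fact (2 * M + 1)) * ((INR (M + k) + 1 / 2) *
    prod_lt (fun i => (INR (M + k) + 1 / 2) ^ 2 - (INR i + 1 / 2) ^ 2) M).
Proof.
  assert (H := prod_lt_half_int (M + k) M ltac:(lia)).
  replace (M + k - M)%nat with k in H by lia.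
  assert (Hk := INR_fact_neq_0 k). assert (HM := INR_fact_neq_0 (2 * M + 1)).
  apply Rmult_eq_reg_r with (INR (fact k)); [|exact Hk].
  rewrite !(Rmult_assoc (2 / _)), (Rmult_assoc (_ + _)), H.
  unfold Defs.mult. destruct k as [|k].
  (* The multiplicity at k = 0 is set to 1 separately; the general formula agrees since 2 (M + 1/2)
     (2M)! = (2M + 1)!. *)
  - replace (M + 0 + M)%nat with (2 * M)%nat by lia. rewrite Nat.add_0_r.
    replace (fact (2 * M + 1)) with ((2 * M + 1) * fact (2 * M))%nat
      by (rewrite Nat.add_1_r; apply eq_sym, fact_simpl).
    rewrite mult_INR, plus_INR, mult_INR. simpl fact. simpl INR.
    pose proof (INR_fact_neq_0 (2 * M)). pose proof (pos_INR M).
    field. split; [assumption|lra].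
  - replace (S k + 2 * S M - 2)%nat with (M + S k + M)%nat by lia.
    replace (2 * S M - 1)%nat with (2 * M + 1)%nat by lia.
    rewrite plus_INR, (S_INR M). field. now split.
Qed.

Lemma heat_trace_half_term (M : nat) (K : nat -> R) (t : R) :
  K_constants (S M) K -> 0 < t < 1 ->
  heat_trace (S M) t = 2 / INR (fact (2 * M + 1)) * exp ((INR M + 1 / 2) ^ 2 * t)
    * sum_f_R0 (fun s => K s * Series (half_term (M - s) t)) M.
Proof.
  intros HK Ht.
  set (c := 2 / INR (fact (2 * M + 1)) * exp ((INR M + 1 / 2) ^ 2 * t)).
  set (v := fun j => sum_f_R0 (fun s => K s * half_term (M - s) t j) M).
  assert (Hv : forall j, v j = (INR j + 1 / 2) *
    prod_lt (fun i => (INR j + 1 / 2) ^ 2 - (INR i + 1 / 2) ^ 2) M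
    * exp (- t * (INR j + 1 / 2) ^ 2)).
  { intro j. specialize (HK (INR j + 1 / 2)).
    replace (S M - 1)%nat with M in HK by lia. rewrite HK, sum_n_Reals.
    rewrite (Rmult_comm (INR j + 1 / 2)), Rmult_assoc, (Rmult_comm (sum_f_R0 _ _)), scal_sum.
    apply sum_eq. intros s Hs. unfold half_term.
    replace (2 * (M - s) + 1)%nat with (S (2 * S M - 2 - 2 * s)) by lia. simpl pow. ring. }
  destruct (Series_sum_f_R0 (fun s j => K s * half_term (M - s) t j) M) as [Hex Hsum].
  { intro s. apply (ex_series_scal (K := R_AbsRing) (V := R_NormedModule)).
    now apply half_term_ex_series. }
  fold v in Hex. change (Series v = sum_f_R0 (fun s => Series (fun j => K s * half_term (M - s) t j)) M) in Hsum.
  rewrite (sum_eq _ (fun s => Series (fun j => K s * half_term (M - s) t j)))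
    by (intros; now rewrite Series_scal_l).
  rewrite <- Hsum.
  unfold heat_trace. rewrite (Series_ext _ (fun k => c * v (M + k)%nat)).
  (* The trace sums v from j = M on. The terms j < M are zero because j + 1/2 is then a root of the
     product; [Series_incr_n] needs a positive shift, hence the case M = 0. *)
  - rewrite Series_scal_l. f_equal. destruct M as [|M]; [reflexivity|].
    rewrite (Series_incr_n v (S M)) by (exact Hex || lia). simpl Nat.pred.
    (* Zero is written as a product so that [scal_sum] can factor it out of the sum. *)
    rewrite (sum_eq v (fun _ => 0 * 0)).
    + rewrite <- scal_sum. ring.
    + intros j Hj. rewrite Hv, (prod_lt_root _ (S M) j) by (lia || ring). ring.
  - intro k. rewrite Hv, mult_eq_prod. unfold c, eigenvalue.
    replace (- t * (INR k * (INR k + 2 * INR (S M) - 1)))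
      with ((INR M + 1 / 2) ^ 2 * t + - t * (INR (M + k) + 1 / 2) ^ 2)
      by (rewrite plus_INR, S_INR; field).
    rewrite exp_plus. ring.
Qed.

(** * Comparison of coefficients *)

Lemma sum_gap (u : nat -> R) (m q : nat) :
  (forall k, (1 <= k <= m)%nat -> u k = 0) ->
  sum_f_R0 u q = u 0%nat + sum_n_m u (S m) q.
Proof.
  intro H. induction q as [|q IH].
  - rewrite sum_n_m_zero by lia. change (u 0%nat = u 0%nat + 0). ring.
  - rewrite tech5, IH. destruct (le_lt_dec (S q) m) as [Hq|Hq].
    + rewrite !sum_n_m_zero, (H (S q)) by lia. change (u 0%nat + 0 + 0 = u 0%nat + 0). ring.
    + rewrite sum_n_Sm by lia.
      change (u 0%nat + sum_n_m u (S m) q + u (S q) = u 0%nat + (sum_n_m u (S m) q + u (S q))).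
      ring.
Qed.

Lemma half_coef_0 (B : nat -> R) (m : nat) : bernoulli_numbers B ->
  half_coef B m 0 = INR (fact m).
Proof.
  intro HB. unfold half_coef. change (2 * 0)%nat with 0%nat. cbn [gauss_prim_deriv].
  rewrite mid_bern_0, gauss_prim_0 by exact HB. field.
Qed.

(** The derivative at 0 has order 2p - 1, below the order of vanishing 2m + 1 of y^(2m+1) exp (-
    y^2). *)
Lemma half_coef_gap (B : nat -> R) (m p : nat) : (1 <= p <= m)%nat -> half_coef B m p = 0.
Proof.
  intro Hp. unfold half_coef. replace (2 * p)%nat with (S (2 * p - 1)) by lia.
  cbn [gauss_prim_deriv]. rewrite gauss_deriv_0_lt by lia. ring.
Qed.

(** Write 2p - 1 = 2m + 1 + 2r with r = p - m - 1: the derivative at 0 is (-1)^r (2p-1)! / r!, the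
    quotient by (2p)! leaves 1 / (2p), and the factor -2 turns the sign into (-1)^(r+1) =
    (-1)^(p+m). *)
Lemma half_coef_gt (B : nat -> R) (m p : nat) : (m < p)%nat ->
  half_coef B m p = (-1) ^ (p + m) * (B (2 * p)%nat / (INR p * INR (fact (p - S m))))
                    * (1 / 2 ^ (2 * p - 1) - 1).
Proof.
  intro Hp. remember (p - S m)%nat as r eqn:Er.
  assert (Ep : p = (r + S m)%nat) by lia.
  unfold half_coef, mid_bern.
  replace (2 * p)%nat with (S (2 * m + 1 + 2 * r)) by lia.
  cbn [gauss_prim_deriv]. rewrite gauss_deriv_0_even.
  replace (S (2 * m + 1 + 2 * r) - 1)%nat with (2 * m + 1 + 2 * r)%nat by lia.
  rewrite fact_simpl, mult_INR.
  replace (INR (S (2 * m + 1 + 2 * r))) with (2 * INR p)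
    by (rewrite <- (mult_INR 2); f_equal; lia).
  replace (p + m)%nat with (S (r + 2 * m)) by lia.
  replace ((-1) ^ S (r + 2 * m)) with (- (-1) ^ r)
    by (rewrite <- tech_pow_Rmult, pow_add, pow_1_even; ring).
  assert (H2 : 2 ^ (2 * m + 1 + 2 * r) <> 0) by (apply pow_nonzero; lra).
  pose proof (INR_fact_neq_0 r). pose proof (INR_fact_neq_0 (2 * m + 1 + 2 * r)).
  assert (INR p <> 0) by (apply not_0_INR; lia).
  change (2 ^ S (2 * m + 1 + 2 * r)) with (2 * 2 ^ (2 * m + 1 + 2 * r)).
  field. repeat split; assumption.
Qed.

Lemma heat_trace_asym (M : nat) (K B : nat -> R) (N : nat) :
  K_constants (S M) K -> bernoulli_numbers B ->
  asym N (fun t => t ^ S M * heat_trace (S M) t)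
    (fun n => / INR (fact (2 * M + 1)) * sum_f_R0 (fun s => K s *
       (if (n <? s)%nat then 0 else
        sum_f_R0 (fun k => half_coef B (M - s) k
          * (((INR M + 1 / 2) ^ 2) ^ (n - s - k) / INR (fact (n - s - k)))) (n - s))) M).
Proof.
  intros HK HB.
  assert (H : forall s, (s <= M)%nat -> asym N
    (fun t => K s * (t ^ s * (2 * t ^ (M - s + 1) * Series (half_term (M - s) t)
                              * exp ((INR M + 1 / 2) ^ 2 * t))))
    (fun n => K s * (if (n <? s)%nat then 0 else
        sum_f_R0 (fun k => half_coef B (M - s) k
          * (((INR M + 1 / 2) ^ 2) ^ (n - s - k) / INR (fact (n - s - k)))) (n - s)))).
  { intros s _. apply asym_scal.
    apply (asym_mult_pow N s _ (fun n => sum_f_R0 (fun k => half_coef B (M - s) k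
      * (((INR M + 1 / 2) ^ 2) ^ (n - k) / INR (fact (n - k)))) n)).
    apply (asym_mult N _ _ _ (fun n => ((INR M + 1 / 2) ^ 2) ^ n / INR (fact n)));
      [now apply half_term_asym|apply asym_exp]. }
  generalize (asym_scal _ (/ INR (fact (2 * M + 1))) _ _ (asym_sum N M _ _ H)).
  apply asym_ext; [|reflexivity]. intros t Ht.
  rewrite (heat_trace_half_term M K t HK Ht).
  rewrite (sum_eq _ (fun s => (K s * Series (half_term (M - s) t))
    * (2 * t ^ S M * exp ((INR M + 1 / 2) ^ 2 * t)))).
  - rewrite <- scal_sum. unfold Rdiv. ring.
  (* The factor t^(M-s+1) is the normalisation of [half_term_asym]; the remaining t^s shifts the
     coefficients by s. *)
  - intros s Hs. replace (t ^ S M) with (t ^ s * t ^ (M - s + 1))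
      by (rewrite <- pow_add; f_equal; lia).
    ring.
Qed.

Lemma inv_fact_sub (n s : nat) : (s <= n)%nat ->
  inv_fact (Z.of_nat n - Z.of_nat s) = / INR (fact (n - s)).
Proof.
  intro H. unfold inv_fact. rewrite <- Nat2Z.inj_sub by exact H.
  destruct (Z.ltb_spec (Z.of_nat (n - s)) 0) as [Hn|_]; [lia|].
  now rewrite Nat2Z.id.
Qed.

(* sum_n_m f a b is zero when b < a. In the inner sum, n - t is truncated
   subtraction; for n < t the upper limit 0 is still below nu - t >= 1. No
   subtraction inside the summand of that sum is truncated on its range. *)
Theorem theorem1p5 (nu : nat) (hnu : (1 <= nu)%nat)
  (a : nat -> R) (ha : heat_invariants nu a)
  (K : nat -> R) (hK : K_constants nu K)
  (B : nat -> R) (hB : bernoulli_numbers B) (n : nat) :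
  a n =
  / INR (fact (2 * nu - 1)) *
  ( sum_n (fun t : nat =>
       INR (fact (nu - 1 - t)) * inv_fact (Z.of_nat n - Z.of_nat t)
       * powerRZ (INR nu - 1 / 2) (2 * Z.of_nat n - 2 * Z.of_nat t) * K t)
      (nu - 1)
  + sum_n (fun t : nat =>
       K t *
       sum_n_m (fun p : nat =>
           (-1) ^ (p + nu - t - 1)
           * ((INR nu - 1 / 2) ^ (2 * n - 2 * t - 2 * p) * B (2 * p)%nat
              / (INR p * INR (fact (n - t - p)) * INR (fact (p + t - nu))))
           * (1 / 2 ^ (2 * p - 1) - 1))
         (nu - t) (n - t))
      (nu - 1) ).
Proof.
  destruct nu as [|M]; [lia|].
  rewrite (heat_invariants_unique (S M) a _ ha (fun N => heat_trace_asym M K B N hK hB)).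
  replace (2 * S M - 1)%nat with (2 * M + 1)%nat by lia.
  replace (INR (S M) - 1 / 2) with (INR M + 1 / 2) by (rewrite S_INR; field).
  replace (S M - 1)%nat with M by lia.
  assert (Hc : INR M + 1 / 2 <> 0) by (pose proof (pos_INR M); lra).
  f_equal. rewrite !sum_n_Reals, <- sum_plus. apply sum_eq. intros s Hs.
  destruct (Nat.ltb_spec n s) as [Hn|Hn].
  (* For n < s both contributions are zero by convention: the reciprocal factorial and the empty
     inner range. *)
  - unfold inv_fact. destruct (Z.ltb_spec (Z.of_nat n - Z.of_nat s) 0) as [_|H]; [|lia].
    rewrite sum_n_m_zero by lia. change (K s * 0 = INR (fact (M - s)) * 0
      * powerRZ (INR M + 1 / 2) (2 * Z.of_nat n - 2 * Z.of_nat s) * K s + K s * 0). ring.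
  (* In the Cauchy product, index 0 gives the first sum of the theorem, indices 1 to M - s vanish,
     and the later ones give the Bernoulli sum. *)
  - rewrite (sum_gap _ (M - s)).
    2:{ intros k Hk. rewrite half_coef_gap by exact Hk. ring. }
    rewrite half_coef_0, Nat.sub_0_r, inv_fact_sub by assumption.
    replace (2 * Z.of_nat n - 2 * Z.of_nat s)%Z with (Z.of_nat (2 * (n - s))) by lia.
    rewrite <- pow_powerRZ, pow_mult.
    replace (S M - s)%nat with (S (M - s)) by lia.
    rewrite (sum_n_m_ext_loc _ (fun p : nat =>
      (-1) ^ (p + S M - s - 1)
      * ((INR M + 1 / 2) ^ (2 * n - 2 * s - 2 * p) * B (2 * p)%nat
         / (INR p * INR (fact (n - s - p)) * INR (fact (p + s - S M))))
      * (1 / 2 ^ (2 * p - 1) - 1)) (S (M - s)) (n - s)).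
    + unfold Rdiv. ring.
    + intros p Hp. rewrite half_coef_gt by lia.
      replace (p + S M - s - 1)%nat with (p + (M - s))%nat by lia.
      replace (p + s - S M)%nat with (p - S (M - s))%nat by lia.
      replace (2 * n - 2 * s - 2 * p)%nat with (2 * (n - s - p))%nat by lia.
      rewrite <- pow_mult.
      assert (INR p <> 0) by (apply not_0_INR; lia).
      eq_R. field. repeat split; try apply INR_fact_neq_0; try assumption.
      apply pow_nonzero; lra.
Qed.
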